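(* Let $\Delta$ be a simplicial complex on $[n]=\{1,\dots,n\}$, let $\mathbb{K}$ be a field, and let $I_\Delta\subseteq R=\mathbb{K}[x_1,\dots,x_n]$ be the Stanley-Reisner ideal of $\Delta$. Then $I_\Delta$ is ass-decomposable if and only if $\Delta$ is vertex decomposable.
   Context: A simplicial complex $\Delta$ on the vertex set $V=[n]$ is a collection of subsets of $V$ (faces) such that $\{v\}\in\Delta$ for all $v\in V$, and $G\subseteq F\in\Delta$ implies $G\in\Delta$. Facets are the faces that are maximal under inclusion; $\Delta$ is a simplex if it has exactly one facet. The Stanley-Reisner ideal $I_\Delta$ is generated by the squarefree monomials $\prod_{i\in F}x_i$ with $F\subseteq[n]$, $F\notin\Delta$. For a vertex $v$, $\mathrm{link}_\Delta(v)=\{G\in\Delta : v\notin G,\ G\cup\{v\}\in\Delta\}$ and $\mathrm{del}_\Delta(v)=\{G\in\Delta : v\notin G\}$, each regarded as a simplicial complex on its own vertex set. A vertex $v$ is a shedding vertex of $\Delta$ if every facet of $\mathrm{del}_\Delta(v)$ is a facet of $\Delta$. Recursively, $\Delta$ is vertex decomposable if either it is a simplex or there is a shedding vertex $v$ of $\Delta$ such that both $\mathrm{link}_\Delta(v)$ and $\mathrm{del}_\Delta(v)$ are vertex decomposable. For an ideal $I\subseteq R$, $\mathrm{ass}(I)$ is the set of associated primes of $R/I$. Recursively, a (proper) monomial ideal $I\subset R$ is called ass-decomposable if either it is a primary ideal, or else there exist a variable $x_i\notin\sqrt{I}$ and a positive integer $k$ such that (i) $\mathrm{ass}(I+(x_i^k))=\{\mathfrak{p}\in\mathrm{ass}(I)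 : x_i\in\mathfrak{p}\}$, and (ii) both $I+(x_i^k)$ and $I:x_i^k$ are ass-decomposable. *)

(* Defs.v *)
From mathcomp Require Import all_boot all_order all_algebra.
From mathcomp Require Import mpoly.

Set Implicit Arguments.
Unset Strict Implicit.
Unset Printing Implicit Defensive.

Import GRing.Theory.
Local Open Scope ring_scope.

Section SimplicialComplexes.

Variable T : finType.
Implicit Types (D : {set {set T}}) (v : T).

Definition simplicial_complex_on (V : {set T}) D : Prop :=
  [/\ forall F : {set T}, F \in D -> F \subset V,
      forall v, v \in V -> [set v] \in D
    & forall F G : {set T}, F \in D -> G \subset F -> G \in D].

(* A complex on V has V as its set of vertices; links and deletions are kept
   over the ambient type T, and their vertex sets are recovered this way. *)
Definition vertices D : {set T} := [set v | [set v] \in D].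

Definition facets D : {set {set T}} := [set F | maxset (fun G => G \in D) F].

Definition is_simplex D : bool := #|facets D| == 1%N.

Definition link D v : {set {set T}} :=
  [set G in D | (v \notin G) && (v |: G \in D)].

Definition del D v : {set {set T}} := [set G in D | v \notin G].

Definition shedding_vertex D v : bool :=
  (v \in vertices D) && (facets (del D v) \subset facets D).

Inductive vertex_decomposable D : Prop :=
| VDSimplex of is_simplex D
| VDShed v of shedding_vertex D v
    & vertex_decomposable (link D v) & vertex_decomposable (del D v).

End SimplicialComplexes.

(* Ideals are Prop-valued predicates, compared extensionally: the predicates
   of ring_quotient are boolean (and proper), whereas membership in the ideals
   below is not given by a decision procedure. *)
Section Ideals.

Variable R : comNzRingType.
Implicit Types (I J P S : R -> Prop) (a b f g : R).

Record is_ideal I : Prop := IsIdeal {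
  ideal0 : I 0;
  idealD : forall f g, I f -> I g -> I (f + g);
  idealM : forall a f, I f -> I (a * f) }.

Definition proper I : Prop := ~ I 1.

Definition ideal_gen S : R -> Prop :=
  fun f => forall I, is_ideal I -> (forall s, S s -> I s) -> I f.

Definition principal a : R -> Prop := ideal_gen (fun f => f = a).

Definition ideal_add I J : R -> Prop :=
  fun f => exists g h, [/\ I g, J h & f = g + h].

(* I : a, which is also the annihilator of the class of a in R / I *)
Definition ideal_colon I a : R -> Prop := fun f => I (f * a).

Definition radical I : R -> Prop := fun f => exists m : nat, I (f ^+ m).

Definition prime_ideal P : Prop :=
  [/\ is_ideal P, proper P & forall a b, P (a * b) -> P a \/ P b].

Definition primary_ideal I : Prop :=
  [/\ is_ideal I, proper I & forall a b, I (a * b) -> I a \/ radical I b].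

Definition ass I P : Prop :=
  prime_ideal P /\ exists a, forall f, P f <-> ideal_colon I a f.

End Ideals.

Section MonomialIdeals.

Variables (n : nat) (K : fieldType).
Implicit Type I : {mpoly K[n]} -> Prop.

Definition monomial_ideal I : Prop :=
  exists M : 'X_{1..n} -> Prop,
    forall f, I f <-> ideal_gen (fun g => exists2 m, M m & g = 'X_[m]) f.

Inductive ass_decomposable I : Prop :=
| ADPrimary of monomial_ideal I & proper I & primary_ideal I
| ADSplit (i : 'I_n) (k : nat) of
    monomial_ideal I & proper I
    & ~ radical I 'X_i & (0 < k)%N
    & (forall P, ass (ideal_add I (principal ('X_i ^+ k))) P
                 <-> ass I P /\ P 'X_i)
    & ass_decomposable (ideal_add I (principal ('X_i ^+ k)))
    & ass_decomposable (ideal_colon I ('X_i ^+ k)).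

Definition stanley_reisner (D : {set {set 'I_n}}) : {mpoly K[n]} -> Prop :=
  ideal_gen (fun f => exists2 F : {set 'I_n}, F \notin D
                      & f = \prod_(i in F) 'X_i).

End MonomialIdeals.

Arguments stanley_reisner {n} K D _.

(* Main.v *)
Require Import Defs.
From mathcomp Require Import all_boot all_order all_algebra.
From mathcomp Require Import mpoly.

Set Implicit Arguments.
Unset Strict Implicit.
Unset Printing Implicit Defensive.

Import GRing.Theory.

(** Splitting [I_Delta] along a variable [x_i] is the algebraic shadow of
    shedding the vertex [i].  Write [I_D] for the ideal spanned by the monomials
    whose support is not a face of [D], where [D] is any down-closed family: the
    ground set is not required to consist of vertices, so that links and
    deletions stay inside the same class.

    The associated primes of [I_D] are the ideals [P_F] generated by the
    variables outside [F], for [F] a facet of [D] ([ass_nonface]); in particular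
    [I_D] is primary exactly when [D] is a simplex ([primary_nonface]).  Moreover
    [I_D + (x_i)] is [I_(del D i)], and [I_D : x_i^k] is [I_(star D i)], where the
    star is the cone with apex [i] over [link D i].

    Suppose now that [I_D] is split along [x_i] with exponent [k].  If [k >= 2],
    every facet [G] of the link yields an associated prime [P_G] of
    [I_D + (x_i^k)], the annihilator of [x_G x_i^(k-1)].  It is not associated to
    [I_D], since [G] is properly contained in the face [G + i]; this violates the
    condition on associated primes ([split_exponent]).  Hence [k = 1], the split
    stays among squarefree ideals, and comparing the primes [P_F] turns the
    condition into: the facets of [del D i] are the facets of [D] that avoid [i].
    That says that [i] is a shedding vertex ([split_condition]).

    The two recursions therefore agree, except that the algebraic one continues
    with the star where the combinatorial one continues with the link.  This is
    harmless because a cone is vertex decomposable if and only if its base is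
    ([vd_cone]).  From ideals to complexes one inducts on the decomposition; from
    complexes to ideals the star is not a subterm of the decomposition, so the
    induction is on the number of faces. *)

(** * Cones, stars and shedding vertices *)

Section Cones.

Variable T : finType.
Implicit Types (D L : {set {set T}}) (F G : {set T}) (v w : T).

Definition down_closed D := forall F G, F \in D -> G \subset F -> G \in D.

Lemma facetP D F :
  reflect (F \in D /\ forall G, G \in D -> F \subset G -> G = F) (F \in facets D).
Proof. by rewrite inE; apply: maxsetP. Qed.

Lemma exists_facet D F : F \in D -> exists2 G, G \in facets D & F \subset G.
Proof.
move=> FD; have [G maxG FG] := @maxset_exists _ (fun A => A \in D) F FD.
by exists G; rewrite ?inE.
Qed.

Lemma link_down_closed D v : down_closed D -> down_closed (link D v).
Proof.
move=> cD F G; rewrite !inE => /and3P[FD vF vFD] GF.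
rewrite (cD F G) // (cD (v |: F)) ?setUS // andbT.
by apply: contra vF => /(subsetP GF).
Qed.

Lemma del_down_closed D v : down_closed D -> down_closed (del D v).
Proof.
move=> cD F G; rewrite !inE => /andP[FD vF] GF.
by rewrite (cD F G) //=; apply: contra vF => /(subsetP GF).
Qed.

Definition cone L v : {set {set T}} := [set G | G :\ v \in L].

Lemma cone_down_closed L v : down_closed L -> down_closed (cone L v).
Proof. by move=> cL F G; rewrite !inE => FL GF; apply: cL FL _; apply: setSD. Qed.

Definition avoids L v := forall F, F \in L -> v \notin F.

Lemma link_avoids L v w : avoids L v -> avoids (link L w) v.
Proof. by move=> aL F; rewrite inE => /andP[/aL]. Qed.

Lemma del_avoids L v w : avoids L v -> avoids (del L w) v.
Proof. by move=> aL F; rewrite inE => /andP[/aL]. Qed.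

(** A maximal face of a cone contains the apex, since the apex can be added to
    any face; removing it leaves a maximal face of the base. *)
Lemma facets_cone L v : avoids L v ->
  facets (cone L v) = [set v |: F | F in facets L].
Proof.
move=> aL; apply/setP=> G; apply/facetP/imsetP => [[GL maxG]|[F FL ->]].
  have vG : v \in G.
    rewrite -(maxG (v |: G)) ?setU11 ?subsetUr //.
    by move: GL; rewrite !inE setDUl setDv set0U.
  exists (G :\ v); last by rewrite setD1K.
  apply/facetP; split=> [|F FL sGF]; first by rewrite inE in GL.
  rewrite -(maxG (v |: F)) ?setU1K ?aL ?inE ?setU1K ?aL //.
  by rewrite -(setD1K vG) setUS.
case/facetP: FL => FL maxF; split=> [|H]; first by rewrite inE setU1K ?aL.
rewrite inE subUset sub1set => HL /andP[vH FH].
by rewrite -(maxF (H :\ v)) ?setD1K // subsetD1 FH aL.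
Qed.

Lemma set1_setD1 v w : w != v -> [set w] :\ v = [set w].
Proof. by move=> wv; apply/setDidPl; rewrite disjoints1 inE. Qed.

Lemma link_cone L v w : w != v -> link (cone L v) w = cone (link L w) v.
Proof.
move=> wv; apply/setP=> G; rewrite !inE wv setDUl.
by rewrite (set1_setD1 wv).
Qed.

Lemma del_cone L v w : w != v -> del (cone L v) w = cone (del L w) v.
Proof. by move=> wv; apply/setP=> G; rewrite !inE wv. Qed.

Lemma del_cone_apex L v : avoids L v -> del (cone L v) v = L.
Proof.
move=> aL; apply/setP=> G; rewrite !inE; case: (boolP (v \in G)) => vG /=.
  by rewrite andbF; apply/esym/negP => /aL; rewrite vG.
by rewrite andbT (_ : G :\ v = G) //; apply/setDidPl; rewrite disjoint_sym disjoints1.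
Qed.

Lemma vertices_cone L v w : w != v -> (w \in vertices (cone L v)) = (w \in vertices L).
Proof.
move=> wv; rewrite !inE.
by rewrite (set1_setD1 wv).
Qed.

Lemma imset_setU1_sub v (A B : {set {set T}}) :
  avoids A v -> avoids B v ->
  ([set v |: F | F in A] \subset [set v |: F | F in B]) = (A \subset B).
Proof.
move=> aA aB; apply/idP/idP => [sAB|]; last exact: imsetS.
apply/subsetP=> F FA.
have /imsetP[G GB eFG] := subsetP sAB _ (imset_f (fun F => v |: F) FA).
by rewrite -(setU1K (aA _ FA)) eFG setU1K ?aB.
Qed.

Lemma facets_avoids L v : avoids L v -> avoids (facets L) v.
Proof. by move=> aL F /facetP[/aL]. Qed.

(** Coning commutes with deletion and adds the apex to every facet, so the
    inclusion of facets that defines shedding is unchanged. *)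
Lemma shedding_cone L v w : avoids L v -> w != v ->
  shedding_vertex (cone L v) w = shedding_vertex L w.
Proof.
move=> aL wv; have aLw := del_avoids (w := w) aL.
rewrite /shedding_vertex vertices_cone // del_cone // !facets_cone //.
by rewrite imset_setU1_sub //; apply: facets_avoids.
Qed.

Lemma is_simplex_cone L v : avoids L v -> is_simplex (cone L v) = is_simplex L.
Proof.
move=> aL; rewrite /is_simplex facets_cone // card_in_imset // => F G FL GL eFG.
by rewrite -(setU1K (facets_avoids aL FL)) eFG setU1K ?(facets_avoids aL).
Qed.

(** Away from the apex, links, deletions and shedding commute with coning, so
    decompositions of the base and of the cone translate step by step into each
    other. *)
Lemma vd_cone L v : avoids L v ->
  vertex_decomposable (cone L v) <-> vertex_decomposable L.
Proof.
move=> aL; split=> [vdC|vdL].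
  move eC: (cone L v) vdC => C vdC.
  elim: vdC L eC aL => {C} C => [sC|w shC _ IHl vd_d IHd] L eC aL; subst C.
    by apply: VDSimplex; rewrite -(is_simplex_cone aL).
  have [wv|wv] := eqVneq w v; last first.
    apply: (VDShed (v := w)); rewrite -?(shedding_cone aL wv) //.
      by apply: IHl; [rewrite link_cone|apply: link_avoids].
    by apply: IHd; [rewrite del_cone|apply: del_avoids].
  (* Shedding the apex would already leave a decomposition of the base. *)
  by move: vd_d; rewrite wv del_cone_apex.
elim: vdL aL => {}L => [sL|w shL _ IHl _ IHd] aL.
  by apply: VDSimplex; rewrite is_simplex_cone.
have wv : w != v.
  apply: contraTneq shL => ->; rewrite /shedding_vertex inE negb_and.
  by apply/orP; left; apply/negP=> /aL; rewrite set11.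
apply: (VDShed (v := w)); rewrite ?shedding_cone ?link_cone ?del_cone //.
  by apply: IHl; apply: link_avoids.
by apply: IHd; apply: del_avoids.
Qed.

(** Identifies the cone over the link with the star, the form in which it
    appears as the complex of a colon ideal. *)
Lemma star_cone_link D v : down_closed D ->
  cone (link D v) v = [set G | v |: G \in D].
Proof.
move=> cD; apply/setP=> G; rewrite !inE eqxx /=.
have -> : v |: G :\ v = v |: G.
  by apply/setP=> x; rewrite !inE; case: (x == v).
apply/andb_idl => vGD; apply: cD vGD _.
by apply: subset_trans (subsetUr _ _); apply: subD1set.
Qed.

Lemma avoids_link D v : avoids (link D v) v.
Proof. by move=> F; rewrite inE => /and3P[]. Qed.

(** A facet of [D] avoiding [v] always remains a facet of the deletion, so the
    inclusion required of a shedding vertex upgrades to an equality. *)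
Lemma shedding_facets D v :
  v \in vertices D ->
  shedding_vertex D v <->
  forall F, F \in facets (del D v) <-> F \in facets D /\ v \notin F.
Proof.
rewrite /shedding_vertex => ->; split=> [/subsetP shD F|eqF]; last first.
  by apply/subsetP=> F /eqF[].
split=> [Fd|[/facetP[FD maxF] vF]].
  by split; [apply: shD | case/facetP: Fd; rewrite inE => /andP[]].
apply/facetP; split=> [|G]; first by rewrite inE FD.
by rewrite inE => /andP[GD _]; apply: maxF.
Qed.

(** A facet of the deletion is a facet of [D], hence cannot be enlarged by the
    shedding vertex, and so lies outside the star.  This makes induction on the
    number of faces possible. *)
Lemma star_proper D v : down_closed D -> shedding_vertex D v ->
  cone (link D v) v \proper D.
Proof.
move=> cD /andP[vD /subsetP sh]; rewrite star_cone_link //.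
have [G Gdel _] : exists2 G, G \in facets (del D v) & set0 \subset G.
  apply: exists_facet; rewrite !inE in vD *.
  by rewrite (cD _ _ vD) ?sub0set.
apply/properP; split.
  by apply/subsetP=> F; rewrite inE => /cD->; rewrite ?subsetUr.
have /facetP[GD maxG] := sh _ Gdel; exists G => //.
rewrite inE; apply/negP=> /maxG/(_ (subsetUr _ _)) eG.
by case/facetP: Gdel; rewrite inE -eG setU11 andbF.
Qed.

Lemma del_proper D v : v \in vertices D -> del D v \proper D.
Proof.
rewrite inE => vD; apply/properP; split; first by apply/subsetP=> F; rewrite inE => /andP[].
by exists [set v] => //; rewrite !inE eqxx andbF.
Qed.

Lemma is_simplexP D : down_closed D ->
  reflect (set0 \in D /\ vertices D \in D) (is_simplex D).
Proof.
move=> cD; have sub_vert F : F \in D -> F \subset vertices D.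
  by move=> FD; apply/subsetP=> x xF; rewrite inE (cD F) ?sub1set.
apply: (iffP cards1P) => [[F eF]|[_ VD]].
  have /facetP[FD maxF] : F \in facets D by rewrite eF set11.
  split; first by apply: cD FD _; apply: sub0set.
  apply: cD FD _; apply/subsetP=> x; rewrite inE => /exists_facet[G].
  by rewrite eF inE => /eqP->; rewrite sub1set.
exists (vertices D); apply/setP=> G; rewrite [RHS]inE; apply/facetP/eqP => [[GD maxG]|->].
  by rewrite (maxG _ VD) ?sub_vert.
by split=> // H HD sVH; apply/eqP; rewrite eqEsubset sVH sub_vert.
Qed.

End Cones.

(** * Ideals up to extensional equality *)

Definition same_ideal (R : comNzRingType) (I J : R -> Prop) :=
  forall f, I f <-> J f.

Section IdealOperations.

Local Open Scope ring_scope.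

Variable R : comNzRingType.
Implicit Types (I J S : R -> Prop) (a f g : R).

Lemma ideal_gen_ideal S : is_ideal (ideal_gen S).
Proof.
split=> [I idI _|f g Sf Sg I idI SI|a f Sf I idI SI]; first exact: ideal0.
- by apply: idealD; [|apply: Sf|apply: Sg].
- by apply: idealM => //; apply: Sf.
Qed.

Lemma ideal_genW S f : S f -> ideal_gen S f.
Proof. by move=> Sf I _; apply. Qed.

Lemma ideal_add_ideal I J : is_ideal I -> is_ideal J -> is_ideal (ideal_add I J).
Proof.
move=> idI idJ; split.
- by exists 0, 0; rewrite addr0; split=> //; apply: ideal0.
- move=> _ _ [f1 [g1 [If1 Jg1 ->]]] [f2 [g2 [If2 Jg2 ->]]].
  by exists (f1 + f2), (g1 + g2); rewrite addrACA; split=> //; apply: idealD.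
- move=> a _ [f [g [If Jg ->]]].
  by exists (a * f), (a * g); rewrite mulrDr; split=> //; apply: idealM.
Qed.

Lemma ideal_sum I (T : Type) (r : seq T) (P : pred T) (F : T -> R) :
  is_ideal I -> (forall i, P i -> I (F i)) -> I (\sum_(i <- r | P i) F i).
Proof.
by move=> idI IF; apply: big_ind; [apply: ideal0|apply: idealD|].
Qed.

Lemma primary_prod I (T : eqType) (r : seq T) (F : T -> R) :
  primary_ideal I -> I (\prod_(i <- r) F i) ->
  exists2 i, i \in r & radical I (F i).
Proof.
move=> [_ pI prI]; elim: r => [|i r IHr]; first by rewrite big_nil.
rewrite big_cons mulrC => /prI[/IHr[j jr rj]|ri]; last by exists i; rewrite ?mem_head.
by exists j; rewrite // inE jr orbT.
Qed.

Lemma ass_ext I J P : same_ideal I J -> ass I P <-> ass J P.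
Proof.
by move=> eIJ; split=> -[prP [a Pa]]; split=> //; exists a => f;
   split=> [/Pa/eIJ|/eIJ/Pa].
Qed.

Lemma is_ideal_ext I J : same_ideal I J -> is_ideal J -> is_ideal I.
Proof.
move=> e idJ; split; first by apply/e; apply: ideal0.
- by move=> f g /e Jf /e Jg; apply/e; apply: idealD.
- by move=> a f /e Jf; apply/e; apply: idealM.
Qed.

Lemma radical_ext I J f : same_ideal I J -> radical I f <-> radical J f.
Proof. by move=> e; split=> -[m If]; exists m; apply/e. Qed.

Lemma primary_ideal_ext I J : same_ideal I J -> primary_ideal J -> primary_ideal I.
Proof.
move=> e [idJ pJ prJ]; split; first exact: is_ideal_ext idJ.
  by move=> /e.
by move=> a b /e /prJ[Ja|rJb]; [left; apply/e|right; apply/(radical_ext b e)].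
Qed.

Lemma same_ideal_sym I J : same_ideal I J -> same_ideal J I.
Proof. by move=> e f; split=> /e. Qed.

Lemma prime_primary I : prime_ideal I -> primary_ideal I.
Proof.
case=> idI pI prI; split=> // a b /prI[Ia|Ib]; [by left | right].
by exists 1; rewrite expr1.
Qed.

End IdealOperations.

(** * Monomial ideals spanned by upper sets of monomials *)

Section MonomialSpans.

Local Open Scope ring_scope.

Variables (n : nat) (K : fieldType).
Implicit Types (U : pred 'X_{1..n}) (m : 'X_{1..n}) (f g : {mpoly K[n]}).
Implicit Types (F G : {set 'I_n}) (D : {set {set 'I_n}}) (i : 'I_n).

(** An upper set of monomials spans a monomial ideal, in which membership is
    decided monomial by monomial. *)
Definition monomial_span U : {mpoly K[n]} -> Prop := fun f => all U (msupp f).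

Definition upper_closed U := forall m m', U m -> U (m' + m)%MM.

Lemma monomial_spanX U m : monomial_span U 'X_[m] <-> U m.
Proof. by rewrite /monomial_span msuppX /= andbT. Qed.

Lemma monomial_span1 U : monomial_span U 1 <-> U 0%MM.
Proof. by rewrite -mpolyX0 monomial_spanX. Qed.

Lemma monomial_span_ideal U : upper_closed U -> is_ideal (monomial_span U).
Proof.
move=> upU; split; rewrite /monomial_span.
- by rewrite msupp0.
- move=> f g Uf Ug; apply/allP=> m /msuppD_le; rewrite mem_cat.
  by case/orP; apply/allP.
- move=> a f /allP Uf; apply/allP=> m /msuppM_le/allpairsP[[m1 m2] /= [_ m2f ->]].
  by apply/upU/Uf.
Qed.

Lemma monomial_span_min U (I : {mpoly K[n]} -> Prop) f :
  is_ideal I -> (forall m, U m -> I 'X_[m]) -> monomial_span U f -> I f.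
Proof.
move=> idI UI /allP Uf; rewrite (mpolyE f) big_seq.
apply: ideal_sum => // m /Uf /UI Im.
by rewrite -mul_mpolyC; apply: idealM.
Qed.

Lemma monomial_span_eq (U V : pred 'X_{1..n}) : U =1 V ->
  same_ideal (monomial_span U) (monomial_span V).
Proof. by move=> eUV f; rewrite /monomial_span (eq_all eUV). Qed.

Lemma monomial_span_monomial U I : upper_closed U ->
  same_ideal I (monomial_span U) -> monomial_ideal I.
Proof.
move=> upU eI; exists U => f; split=> [/eI Uf|gf].
  apply: monomial_span_min Uf => [|m Um]; first exact: ideal_gen_ideal.
  by apply: ideal_genW; exists m.
apply/eI; apply: gf; first exact: monomial_span_ideal.
by move=> _ [m Um ->]; apply/monomial_spanX.
Qed.

Lemma colon_span U m :
  same_ideal (ideal_colon (monomial_span U) 'X_[m])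
             (monomial_span (fun m' => U (m + m')%MM)).
Proof.
by move=> f; rewrite /ideal_colon /monomial_span (perm_all _ (msuppMX f m)) all_map.
Qed.

(** The union of the two sets of monomials is again an upper set, and each of
    its monomials lies in one of the two summands. *)
Lemma add_span U I i k : upper_closed U -> same_ideal I (monomial_span U) ->
  same_ideal (ideal_add I (principal ('X_i ^+ k)))
             (monomial_span (fun m => U m || (k <= m i)%N)).
Proof.
move=> upU eI; set V := fun m => _; have upV : upper_closed V.
  move=> m m' /orP[/upU Um|km]; rewrite /V ?Um // mnmDE.
  by rewrite (leq_trans km) ?orbT ?leq_addl.
move=> f; split=> [[g [h [/eI Ug Ph ->]]]|].
  apply: idealD; first exact: monomial_span_ideal.
    by apply: sub_all Ug => m; rewrite /V => ->.
  apply: Ph => [|_ ->]; first exact: monomial_span_ideal.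
  rewrite mpolyXn; apply/monomial_spanX.
  by rewrite /V mulmnE mnm1E eqxx mul1n leqnn orbT.
have idS : is_ideal (monomial_span U) by apply: monomial_span_ideal.
have idA : is_ideal (ideal_add I (principal ('X_i ^+ k))).
  by apply: ideal_add_ideal; [apply: is_ideal_ext eI idS|apply: ideal_gen_ideal].
apply: monomial_span_min => // m /orP[Um|km].
  exists 'X_[m], 0; rewrite addr0; split=> //; first exact/eI/monomial_spanX.
  by apply: ideal0; apply: ideal_gen_ideal.
exists 0, 'X_[m]; rewrite add0r; split=> //; first by apply/eI; apply: (ideal0 idS).
have -> : m = ((m - U_(i) *+ k) + U_(i) *+ k)%MM.
  rewrite submK //; apply/mnm_lepP=> j; rewrite mulmnE mnm1E.
  by case: eqP => [<-|]; rewrite ?mul1n ?mul0n.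
rewrite mpolyXD -mpolyXn; apply: (idealM (ideal_gen_ideal _)).
exact: ideal_genW.
Qed.

(** * Stanley-Reisner ideals of down-closed families *)

Definition msupport m : {set 'I_n} := [set i | m i != 0%N].
Definition sqfree F : 'X_{1..n} := [multinom (i \in F : nat) | i < n].

Lemma supportD m m' : msupport (m + m')%MM = msupport m :|: msupport m'.
Proof. by apply/setP=> i; rewrite !inE mnmDE addn_eq0 negb_and. Qed.

Lemma support_sqfree F : msupport (sqfree F) = F.
Proof. by apply/setP=> i; rewrite !inE mnmE; case: (i \in F). Qed.

Lemma supportXn i k : (0 < k)%N -> msupport (U_(i) *+ k)%MM = [set i].
Proof.
move=> k0; apply/setP=> j; rewrite !inE mulmnE mnm1E [j == i]eq_sym.
by rewrite -lt0n muln_gt0 k0 andbT lt0b.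
Qed.

Lemma supportX i : msupport U_(i)%MM = [set i].
Proof. by rewrite -[U_(i)%MM]mulm1n supportXn. Qed.

Lemma support0 : msupport 0%MM = set0.
Proof. by apply/setP=> i; rewrite !inE mnm0E. Qed.

Lemma sqfreeE F : 'X_[sqfree F] = \prod_(i in F) 'X_i :> {mpoly K[n]}.
Proof.
rewrite mpolyXE_id [RHS]big_mkcond; apply: eq_bigr => i _.
by rewrite mnmE; case: (i \in F).
Qed.

Definition nonface D : pred 'X_{1..n} := fun m => msupport m \notin D.

Lemma nonface_upper D : down_closed D -> upper_closed (nonface D).
Proof.
move=> cD m m'; apply: contra => DF; apply: cD DF _.
by rewrite supportD subsetUr.
Qed.

(** A monomial is divisible by the product of the variables in its support;
    conversely, a monomial divisible by the product over a non-face has a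
    non-face as support. *)
Lemma stanley_reisner_span D : down_closed D ->
  same_ideal (stanley_reisner K D) (monomial_span (nonface D)).
Proof.
move=> cD f; have upD := nonface_upper cD; split=> [gf|].
  apply: gf; first exact: monomial_span_ideal.
  move=> _ [F FD ->]; rewrite -sqfreeE; apply/monomial_spanX.
  by rewrite /nonface support_sqfree.
have idS : is_ideal (stanley_reisner K D) by apply: ideal_gen_ideal.
apply: monomial_span_min => // m mD.
have -> : m = ((m - sqfree (msupport m)) + sqfree (msupport m))%MM.
  rewrite submK //; apply/mnm_lepP=> i; rewrite mnmE inE.
  by case: (m i).
rewrite mpolyXD sqfreeE; apply: (idealM idS).
by apply: ideal_genW; exists (msupport m).
Qed.

(** * Associated primes *)

(** The ideal generated by the variables outside [F]. *)
Definition face_prime F := monomial_span (fun m => ~~ (msupport m \subset F)).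

Lemma face_primeX F i : face_prime F 'X_i <-> i \notin F.
Proof. by rewrite /face_prime monomial_spanX supportX sub1set. Qed.

Lemma face_prime_inj F G : same_ideal (face_prime F) (face_prime G) -> F = G.
Proof.
move=> eFG; apply/setP=> i; apply/negb_inj; apply/idP/idP.
  by move=> /face_primeX/eFG/face_primeX.
by move=> /face_primeX/eFG/face_primeX.
Qed.

(** Substituting these values sets to zero the variables outside [F]; the kernel
    of the substitution is [face_prime F], which explains its primality. *)
Definition kill_outside F : n.-tuple {mpoly K[n]} :=
  [tuple if i \in F then 'X_i else 0 | i < n].

Lemma kill_outsideX F m :
  'X_[m] \mPo kill_outside F = if msupport m \subset F then 'X_[m] else 0.
Proof.
rewrite comp_mpolyX; case: ifPn => [/subsetP mF|/subsetPn[i im iF]].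
  rewrite [RHS]mpolyXE_id; apply: eq_bigr => i _; rewrite tnth_mktuple.
  case: ifPn => // iF; have: i \notin msupport m by apply: contra iF => /mF.
  by rewrite inE negbK => /eqP->; rewrite !expr0.
rewrite (bigD1 i) //= tnth_mktuple (negbTE iF) expr0n.
by move: im; rewrite inE => /negbTE->; rewrite mul0r.
Qed.

Lemma face_prime_kernel F f : face_prime F f <-> f \mPo kill_outside F = 0.
Proof.
rewrite comp_mpolyEX; split=> [/allP Ff|f0].
  rewrite big_seq big1 // => m /Ff; rewrite kill_outsideX => /negbTE->.
  by rewrite scaler0.
apply/allP=> m mf; apply/negP=> mF; move: mf; rewrite mcoeff_msupp => /negP; apply.
move/(congr1 (mcoeff m)): f0; rewrite mcoeff0 raddf_sum /= => <-.
have [mf|mf] := boolP (m \in msupp f); last first.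
  rewrite memN_msupp_eq0 // big_seq big1 // => m' m'f.
  rewrite kill_outsideX mcoeffZ; case: ifP; rewrite ?mcoeff0 ?mulr0 // mcoeffX.
  by case: eqP m'f mf => [->->|]; rewrite ?mulr0.
rewrite (bigD1_seq m) ?msupp_uniq //= kill_outsideX mF mcoeffZ mcoeffX eqxx mulr1.
rewrite big1 ?addr0 // => m' /negbTE m'm; rewrite kill_outsideX mcoeffZ.
by case: ifP; rewrite ?mcoeff0 ?mulr0 // mcoeffX m'm mulr0.
Qed.

Lemma face_prime_prime F : prime_ideal (face_prime F).
Proof.
have up : upper_closed (fun m => ~~ (msupport m \subset F)).
  by move=> m m'; apply: contra; rewrite supportD subUset => /andP[].
split; first exact: monomial_span_ideal.
  by move/monomial_span1; rewrite support0 sub0set.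
move=> a b /face_prime_kernel/eqP; rewrite rmorphM mulf_eq0.
by case/orP=> /eqP ?; [left|right]; apply/face_prime_kernel.
Qed.

(** The annihilator of a monomial modulo a monomial ideal is again spanned by
    monomials, so exhibiting [face_prime F] as associated only requires a check
    on exponents. *)
Lemma ass_span_witness U F m0 :
  (forall m, U (m0 + m)%MM = ~~ (msupport m \subset F)) ->
  ass (monomial_span U) (face_prime F).
Proof.
move=> Um0; split; first exact: face_prime_prime.
by exists 'X_[m0] => f; rewrite (colon_span U m0 f); apply: monomial_span_eq.
Qed.

Lemma prime_ext (P Q : {mpoly K[n]} -> Prop) :
  same_ideal P Q -> prime_ideal Q -> prime_ideal P.
Proof.
move=> e [idQ pQ prQ]; split; first exact: is_ideal_ext idQ.
  by move/e.
by move=> a b /e/prQ[Qa|Qb]; [left|right]; apply/e.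
Qed.

(** For a facet [F], the product of the variables in [F] has annihilator
    [face_prime F].  Conversely, let [P] be the annihilator of [a].  Some
    monomial of [a] is supported on a facet [F], so [a] is not in [face_prime F]
    and primality of the latter gives one inclusion.  For the other, a variable
    [x_i] with [i] outside [F] multiplies [x_F] into the ideal, and [x_F] is not
    in [P]; hence [x_i] is in [P]. *)
Lemma ass_nonface D P : down_closed D ->
  ass (monomial_span (nonface D)) P <->
  exists2 F, F \in facets D & same_ideal P (face_prime F).
Proof.
move=> cD; have idI := monomial_span_ideal (nonface_upper cD).
split=> [[[idP pP prP] [a Pa]]|[F /facetP[FD maxF] eP]]; last first.
  have [prF [b Fb]] : ass (monomial_span (nonface D)) (face_prime F).
    apply: (@ass_span_witness _ _ (sqfree F)) => m.
    rewrite /nonface supportD support_sqfree; congr (~~ _).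
    apply/idP/idP=> [/maxF/(_ (subsetUl _ _)) <-|/setUidPl-> //].
    exact: subsetUr.
  split; first exact: prime_ext prF.
  by exists b => f; split=> [/eP/Fb|/Fb/eP].
(* Otherwise 1 would annihilate the class of a. *)
have : ~~ all (nonface D) (msupp a).
  by apply/negP=> Ia; apply: pP; apply/Pa; rewrite /ideal_colon mul1r.
case/allPn=> m ma /negPn/exists_facet[F Ffac mF].
have aF : ~ face_prime F a by move/allP/(_ _ ma); rewrite mF.
have [idF _ prF] := face_prime_prime F.
have PF f : P f -> face_prime F f.
  move=> /Pa If; have [] // : face_prime F f \/ face_prime F a.
  apply: prF; apply: sub_all If => m' m'D; apply: contra m'D.
  by apply: cD; case/facetP: Ffac.
exists F => // f; split; first exact: PF.
apply: monomial_span_min => // m' /subsetPn[i im iF].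
have Pi : P 'X_i.
  have [|//|/PF] := prP 'X_i 'X_[sqfree F]; last first.
    by move/monomial_spanX; rewrite support_sqfree subxx.
  apply/Pa; rewrite /ideal_colon mulrC; apply: (idealM idI).
  rewrite -mpolyXD; apply/monomial_spanX; rewrite /nonface supportD supportX.
  rewrite support_sqfree; apply: contra iF => iFD.
  case/facetP: Ffac => _ /(_ _ iFD (subsetUr _ _)) <-.
  exact: setU11.
have -> : m' = ((m' - U_(i)) + U_(i))%MM.
  rewrite submK //; apply/mnm_lepP=> j; rewrite mnm1E.
  by case: eqP => // <-; move: im; rewrite inE lt0n.
by rewrite mpolyXD; apply: (idealM idP).
Qed.

Lemma proper_nonface D : Defs.proper (monomial_span (nonface D)) <-> set0 \in D.
Proof.
rewrite /Defs.proper monomial_span1 /nonface support0.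
by case: (set0 \in D); split=> // H; case: H.
Qed.

Lemma radical_nonfaceX D i : down_closed D -> set0 \in D ->
  radical (monomial_span (nonface D)) 'X_i <-> i \notin vertices D.
Proof.
move=> cD D0; rewrite inE; split=> [[[|k]]|iD].
- by rewrite expr0 => /monomial_span1; rewrite /nonface support0 D0.
- by rewrite mpolyXn => /monomial_spanX; rewrite /nonface supportXn.
- by exists 1%N; rewrite expr1; apply/monomial_spanX; rewrite /nonface supportX.
Qed.

(** If the ideal is primary and the vertex set is not a face, the product of all
    vertices is in the ideal, hence some vertex is in its radical, which is
    absurd.  If the vertex set is a face, the ideal is [face_prime] of it. *)
Lemma primary_nonface D : down_closed D -> set0 \in D ->
  primary_ideal (monomial_span (nonface D)) <-> is_simplex D.
Proof.
move=> cD D0; split=> [prI|/(is_simplexP cD)[_ VD]].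
  apply/(is_simplexP cD); split=> //; apply/negPn/negP=> VD.
  have : monomial_span (nonface D) (\prod_(i in vertices D) 'X_i).
    by rewrite -sqfreeE; apply/monomial_spanX; rewrite /nonface support_sqfree.
  rewrite -big_enum => /primary_prod[] // i; rewrite mem_enum => iV.
  by move/(radical_nonfaceX i cD D0); rewrite iV.
apply: (@primary_ideal_ext _ _ (face_prime (vertices D))); last first.
  exact/prime_primary/face_prime_prime.
apply: monomial_span_eq => m; congr (~~ _); apply/idP/idP=> [mD|mV].
  by apply/subsetP=> i im; rewrite inE (cD _ _ mD) ?sub1set.
exact: cD VD mV.
Qed.

(** * Splitting an ideal versus shedding a vertex *)

Lemma add_nonface1 D I i : down_closed D -> same_ideal I (monomial_span (nonface D)) ->
  same_ideal (ideal_add I (principal ('X_i ^+ 1))) (monomial_span (nonface (del D i))).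
Proof.
move=> cD eI f; rewrite (add_span i 1 (nonface_upper cD) eI f).
apply: monomial_span_eq => m; rewrite /nonface !inE negb_and; congr orb.
by rewrite negbK lt0n.
Qed.

Lemma colon_nonface D I i k : down_closed D -> (0 < k)%N ->
  same_ideal I (monomial_span (nonface D)) ->
  same_ideal (ideal_colon I ('X_i ^+ k))
             (monomial_span (nonface (cone (link D i) i))).
Proof.
move=> cD k0 eI f; rewrite mpolyXn; apply: iff_trans (eI _) _.
apply: iff_trans (colon_span _ _ _) _; apply: monomial_span_eq => m.
by rewrite /nonface star_cone_link // supportD supportXn // inE.
Qed.

(** The monomial [x_G x_i^(k-1)], for a facet [G] of the link, has annihilator
    [face_prime G] modulo the enlarged ideal; [k >= 2] is what puts [i] into its
    support, so that multiplying by a variable outside [G] produces either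
    [x_i^k] or a non-face.  But [G] is not a facet of [D]. *)
Lemma split_exponent D I i k : down_closed D -> i \in vertices D -> (1 < k)%N ->
  same_ideal I (monomial_span (nonface D)) ->
  ~ (forall P, ass (ideal_add I (principal ('X_i ^+ k))) P -> ass I P).
Proof.
move=> cD iD k1 eI sub.
have [G /facetP[GL maxG] _] : exists2 G, G \in facets (link D i) & set0 \subset G.
  apply: exists_facet; rewrite !inE setU0 in iD *.
  by rewrite iD (cD _ _ iD) ?sub0set.
have : ass (ideal_add I (principal ('X_i ^+ k))) (face_prime G).
  apply/(ass_ext _ (add_span i k (nonface_upper cD) eI)).
  apply: (@ass_span_witness _ _ (sqfree G + U_(i) *+ k.-1)%MM) => m.
  have k'0 : (0 < k.-1)%N by rewrite -ltnS prednK // ltnW.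
  have iG : i \notin G by apply: avoids_link GL.
  rewrite /nonface !supportD support_sqfree supportXn // !mnmDE mulmnE mnm1E eqxx.
  rewrite mnmE (negbTE iG) add0n mul1n.
  have -> : (k <= k.-1 + m i)%N = (i \in msupport m).
    by rewrite inE -lt0n -{1}[k]prednK ?(ltnW k1) // -addn1 leq_add2l.
  rewrite -[RHS]orbF; apply/idP/idP; rewrite orbF.
    case/orP=> [|im]; last by apply/subsetPn; exists i.
    apply: contra => /setUidPl; rewrite setUAC => ->; rewrite setUC.
    by move: GL; rewrite inE => /and3P[].
  apply: contraNT; rewrite negb_or negbK => /andP[uD im].
  have uL : G :|: msupport m \in link D i.
    have eU : i |: (G :|: msupport m) = G :|: [set i] :|: msupport m.
      by rewrite setUA [[set i] :|: G]setUC.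
    rewrite inE in_setU negb_or iG im eU uD /= andbT.
    by apply: cD uD _; rewrite -eU subsetUr.
  by rewrite -(maxG _ uL) ?subsetUl ?subsetUr.
move/sub/(ass_ext _ eI)/(ass_nonface _ cD) => [F /facetP[_ maxF] /face_prime_inj eGF].
subst F; move: GL; rewrite inE => /and3P[_ iG /maxF/(_ (subsetUr _ _)) eG].
by rewrite -eG setU11 in iG.
Qed.

(** Once the exponent is 1, both sides compare the facets of the deletion with
    the facets of [D] that avoid [i], because [face_prime] is injective. *)
Lemma split_condition D I i k : down_closed D -> i \in vertices D -> (0 < k)%N ->
  same_ideal I (monomial_span (nonface D)) ->
  (forall P, ass (ideal_add I (principal ('X_i ^+ k))) P <-> ass I P /\ P 'X_i) <->
  k = 1%N /\ shedding_vertex D i.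
Proof.
move=> cD iD k0 eI; have cd := del_down_closed (v := i) cD.
have assD P := iff_trans (ass_ext P eI) (ass_nonface P cD).
have assd P := iff_trans (ass_ext P (add_nonface1 i cD eI)) (ass_nonface P cd).
split=> [assP|[-> /(shedding_facets iD) eF] P].
  have ek : k = 1%N.
    case: k k0 assP => [//|[//|k]] _ assP; exfalso.
    by apply: (split_exponent cD iD (isT : (1 < k.+2)%N) eI) => P /assP[].
  split=> //; subst k; apply/(shedding_facets iD) => F; split=> [Fd|[FD iF]].
    have /assd/assP[/assD[G GD /face_prime_inj->] /face_primeX iF] :
      exists2 G, G \in facets (del D i) & same_ideal (face_prime F) (face_prime G).
      by exists F.
    by [].
  have /assP/assd[G Gd /face_prime_inj->] : ass I (face_prime F) /\ face_prime F 'X_i.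
    by split; [apply/assD; exists F|apply/face_primeX].
  by [].
split=> [/assd[F /eF[FD iF] eP]|[/assD[F FD eP] /eP/face_primeX iF]].
  by split; [apply/assD; exists F|apply/eP/face_primeX].
by apply/assd; exists F => //; apply/eF.
Qed.

(** * The two recursions *)

Lemma ad_vd D I : down_closed D -> same_ideal I (monomial_span (nonface D)) ->
  ass_decomposable I -> vertex_decomposable D.
Proof.
move=> cD eI adI; elim: adI D cD eI => {}I.
  move=> _ pI prI D cD eI; have D0 : set0 \in D.
    by apply/proper_nonface => I1; apply: pI; apply/eI.
  apply: VDSimplex; apply/(primary_nonface cD D0).
  exact: primary_ideal_ext (same_ideal_sym eI) prI.
move=> i k _ pI ri k0 assP _ IHa _ IHc D cD eI.
have D0 : set0 \in D by apply/proper_nonface => I1; apply: pI; apply/eI.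
have iD : i \in vertices D.
  by apply/negPn/negP=> /(radical_nonfaceX i cD D0)/(radical_ext _ eI).
have [k1 sh] := (split_condition cD iD k0 eI).1 assP; subst k.
apply: (VDShed sh).
  apply/(vd_cone (@avoids_link _ D i)); apply: IHc; last exact: colon_nonface.
  by apply/cone_down_closed/link_down_closed.
by apply: IHa; [apply: del_down_closed|apply: add_nonface1].
Qed.

Lemma vd_nonempty D : down_closed D -> vertex_decomposable D -> set0 \in D.
Proof.
move=> cD [/(is_simplexP cD)[]|v /andP[]] //; rewrite inE => vD _ _ _.
by apply: cD vD _; apply: sub0set.
Qed.

(** The decomposition of [D] provides the link, whereas the ideal needs the
    star; the star is vertex decomposable by [vd_cone] and has fewer faces. *)
Lemma vd_ad D I : down_closed D -> same_ideal I (monomial_span (nonface D)) ->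
  vertex_decomposable D -> ass_decomposable I.
Proof.
have [N] := ubnP #|D|; elim: N D I => // N IHN D I; rewrite ltnS => leDN cD eI vdD.
have D0 := vd_nonempty cD vdD.
have monI := monomial_span_monomial (nonface_upper cD) eI.
have pI : Defs.proper I by move/eI; apply/proper_nonface.
case: vdD => [sD|i sh vdl vdd].
  by apply: ADPrimary => //; apply: primary_ideal_ext eI _; apply/primary_nonface.
have iD : i \in vertices D by case/andP: sh.
apply: (ADSplit (i := i) (k := 1)) => //.
- by move=> /(radical_ext _ eI)/(radical_nonfaceX i cD D0); rewrite iD.
- exact: (split_condition cD iD (isT : (0 < 1)%N) eI).2.
- apply: (IHN (del D i)) => //; last exact: add_nonface1.
    by apply: leq_trans leDN; apply/proper_card/del_proper.
  exact: del_down_closed.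
- apply: (IHN (cone (link D i) i)).
  + by apply: leq_trans leDN; apply/proper_card/star_proper.
  + exact/cone_down_closed/link_down_closed.
  + exact: colon_nonface.
  + by apply/(vd_cone (@avoids_link _ D i)).
Qed.

End MonomialSpans.

Theorem corollary3p2 (n : nat) (Delta : {set {set 'I_n}})
    (hDelta : simplicial_complex_on [set: 'I_n] Delta) (K : fieldType) :
  ass_decomposable (stanley_reisner K Delta) <-> vertex_decomposable Delta.
Proof.
have cD : down_closed Delta by case: hDelta.
have eI := stanley_reisner_span (K := K) cD.
by split; [apply: ad_vd cD eI | apply: vd_ad cD eI].
Qed.
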